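(* Let $(\lambda_n)$ be a sequence of positive reals with $\lambda_n\to\infty$ (arbitrarily slowly). Then $\mathcal{G}\big(n,p=2(1-\lambda_n n^{-1/3})/n,2\big)$ is w.h.p. adaptably $2$-colorable.
   Context: For a finite simple graph $G=(V,E)$ with a (not necessarily proper) edge coloring $c:E\to\{red,blue\}$, a vertex coloring $\sigma:V\to\{red,blue\}$ is adapted to $c$ if for every edge $uv\in E$ either $\sigma(u)\neq c(uv)$ or $\sigma(v)\ne c(uv)$. The pair $(G,c)$ is adaptably $2$-colorable if there exists a vertex coloring adapted to $c$. $\mathcal{G}(n,p,2)$ is the random pair $(G,c)$ in which each possible edge on $n$ labelled vertices is included independently with probability $p$ (it is understood that $p\in[0,1]$), and each included edge is independently assigned a uniformly random color from $\{red,blue\}$. A sequence of events $A_n$ occurs w.h.p. if $\mathbb{P}[A_n]\to 1$ as $n\to\infty$. ''Arbitrarily slowly'' means that no lower bound on the growth rate of $\lambda_n$ is imposed. *)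

(* Defs.v *)
From HB Require Import structures.
From mathcomp Require Import all_boot all_order all_algebra.
From mathcomp Require Import all_classical all_reals all_analysis.

Set Implicit Arguments.
Unset Strict Implicit.
Unset Printing Implicit Defensive.

Import Order.TTheory GRing.Theory Num.Theory.
Import numFieldNormedType.Exports.

Local Open Scope ring_scope.

Definition color : Type := bool.
HB.instance Definition _ := Finite.on color.
Definition red : color := true.
Definition blue : color := false.

Definition vpair (V : finType) : Type := {e : {set V} | #|e| == 2%N}.
HB.instance Definition _ (V : finType) := Finite.on (vpair V).

(* A pair (G, c), where G is a simple graph on V and c is a not necessarily
   proper red/blue coloring of its edges: a pair e = {u, v} is a non-edge of G
   when it is mapped to None, and an edge with c(e) = k when mapped to
   Some k. *)
Definition ecgraph (V : finType) : Type := {ffun vpair V -> option color}.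
HB.instance Definition _ (V : finType) := Finite.on (ecgraph V).

Definition adapted (V : finType) (Gc : ecgraph V) (sigma : {ffun V -> color}) :
    bool :=
  [forall e : vpair V, forall u : V, forall v : V,
    (val e == [set u; v]%SET) ==>
    if Gc e is Some k then (sigma u != k) || (sigma v != k) else true].

Definition adaptably_2_colorable (V : finType) (Gc : ecgraph V) : bool :=
  [exists sigma : {ffun V -> color}, adapted Gc sigma].

Section RandomColoredGraph.
Variables (R : realType) (n : nat) (p : R).

Definition pair_weight (o : option color) : R :=
  if o is Some _ then p * 2^-1 else 1 - p.

Definition Gnp2_mass (Gc : ecgraph 'I_n) : R :=
  \prod_(e : vpair 'I_n) pair_weight (Gc e).

(* The probability, under G(n, p, 2), of the event A. *)
Definition Gnp2_prob (A : pred (ecgraph 'I_n)) : R :=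
  \sum_(Gc : ecgraph 'I_n | A Gc) Gnp2_mass Gc.

Lemma Gnp2_mass_ge0 (Gc : ecgraph 'I_n) : 0 <= p <= 1 -> 0 <= Gnp2_mass Gc.
Proof.
move=> /andP[p0 p1]; apply: prodr_ge0 => e _; rewrite /pair_weight.
by case: (Gc e) => [_|]; rewrite ?subr_ge0// mulr_ge0// invr_ge0.
Qed.

Lemma Gnp2_prob_total : Gnp2_prob predT = 1.
Proof.
rewrite /Gnp2_prob /Gnp2_mass -(bigA_distr_bigA (fun=> pair_weight)) big1// => e _.
rewrite (bigD1 None)//= (bigD1 (Some red))//= (bigD1 (Some blue))//= big1 ?addr0.
  by rewrite -mulrDr -div1r -splitr mulr1 subrK.
by case=> [[]|].
Qed.

End RandomColoredGraph.

(* Main.v *)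
(* Adapted colorings are the solutions of a 2-SAT instance: an edge of color c
   forbids both ends to be colored c. If there is no solution, some literal
   implies its negation and conversely; following the implications from that
   literal in both directions until a vertex repeats yields a bicycle, i.e. a
   path on k distinct vertices with alternating edge colors, plus two further
   edges joining its ends to vertices of the path. At most 2 k^2 n^k such
   structures exist on k vertices, each present with probability at most
   (p/2)^(k+1). With p = 2(1 - eps)/n the union bound gives
   (2/n) * sum_k k^2 (1 - eps)^k <= 4/(n eps^3), which equals 4/lambda_n^3 for
   eps = lambda_n n^(-1/3). *)
Require Import Defs.
From HB Require Import structures.
From mathcomp Require Import all_boot all_order all_algebra.
From mathcomp Require Import all_classical all_reals all_analysis.
From mathcomp Require Import zify ring lra.

Import Order.TTheory GRing.Theory Num.Theory.
Import numFieldNormedType.Exports.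

Set Implicit Arguments.
Unset Strict Implicit.
Unset Printing Implicit Defensive.

(** Here [t] holds the vertices already visited and [s] continues the walk: [s1] is the stretch of
    new vertices and [b] the first return. *)
Lemma first_repeat (T : Type) (K : eqType) (f : T -> K) (t : seq K)
    (s : seq T) :
  uniq t -> ~~ uniq (map f s ++ t) ->
  exists s1 b s2, [/\ s = s1 ++ b :: s2, uniq (map f s1 ++ t) &
    f b \in map f s1 ++ t].
Proof.
move=> ut; elim/last_ind: s => [|s b IHs]; first by rewrite ut.
case us: (uniq (map f s ++ t)).
  rewrite map_rcons cat_rcons -cat1s uniq_catCA cat1s cons_uniq us andbT negbK.
  by move=> bst; exists s, b, [::]; rewrite cats1.
have /IHs[s1 [d [s2 [-> u1 d1]]]] : ~~ uniq (map f s ++ t) by rewrite us.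
by exists s1, d, (rcons s2 b); rewrite -rcons_cons -rcons_cat.
Qed.

(** * The implication digraph of the 2-SAT instance *)

Section Implication.
Variables (V : finType) (E : bool -> rel V).
Hypothesis E_sym : forall c, symmetric (E c).

Definition lneg (a : V * bool) : V * bool := (a.1, ~~ a.2).

(* The literal (v, c) says that v gets color c: an edge of color c between u
   and v turns the literal (u, c) into (v, ~~ c). *)
Definition limp : rel (V * bool) :=
  fun a b => (b.2 == ~~ a.2) && E a.2 a.1 b.1.

Lemma lnegK : involutive lneg.
Proof. by case=> v c; rewrite /lneg /= negbK. Qed.

(** Contraposition: an edge can be read from either of its ends. *)
Lemma limp_lneg (a b : V * bool) : limp (lneg a) (lneg b) = limp b a.
Proof.
case: a b => [u c] [v d]; rewrite /limp /= E_sym.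
by case: c d => [] [].
Qed.

Lemma connect_lneg (a b : V * bool) :
  connect limp a b -> connect limp (lneg b) (lneg a).
Proof.
case/connectP=> s; elim: s a => [|x s IHs] a /=; first by move=> _ ->.
case/andP=> ax xs bE; apply: connect_trans (IHs _ xs bE) _.
by apply: connect1; rewrite limp_lneg.
Qed.

Definition avoids (sigma : V -> bool) : Prop :=
  forall c u v, E c u v -> (sigma u != c) || (sigma v != c).

(** The 2-SAT criterion. If [v] is undecided in a closed consistent set, all consequences of
    [(v, c)] can be added: a clash with the set would, by contraposition, put [(v, ~~ c)] into it,
    and a clash among the consequences would make [(v, c)] imply [(v, ~~ c)]. *)
Lemma avoids_of_no_contradiction :
  (forall v, exists c : bool, ~~ connect limp (v, c) (v, ~~ c)) ->
  exists sigma, avoids sigma.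
Proof.
move=> nocontra.
pose ok (S : {set V * bool}) :=
  [forall a in S, forall b,
    (connect limp a b ==> (b \in S)) && (lneg a \notin S)].
have okP (S : {set V * bool}) :
    reflect ((forall a b, a \in S -> connect limp a b -> b \in S) /\
             (forall a, a \in S -> lneg a \notin S)) (ok S).
  apply: (iffP forall_inP) => [H|[H1 H2] a aS].
    split=> [a b aS|a aS]; have /forallP Ha := H _ aS.
      by have /andP[/implyP] := Ha b.
    by have /andP[_] := Ha a.
  by apply/forallP => b; rewrite H2 // andbT; apply/implyP; apply: H1.
have ok0 : ok finset.set0 by apply/okP; split=> [a b|a]; rewrite inE.
(* A maximal consistent set of literals closed under implication is total. *)
have [S okS Smax] :=
  @arg_maxnP _ finset.set0 ok (fun S : {set V * bool} => #|S|) ok0.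
have [Scl Scons] := okP _ okS.
have total v : exists c, (v, c) \in S.
  case vt: ((v, true) \in S); first by exists true.
  case vf: ((v, false) \in S); first by exists false.
  have vN c : (v, c) \notin S by case: c; rewrite ?vt ?vf.
  have [c nc] := nocontra v.
  pose S' := S :|: [set b | connect limp (v, c) b].
  have : ok S'.
    apply/okP; split=> [a b|a]; rewrite !inE.
      case/orP=> [aS ab|va ab]; first by rewrite (Scl _ _ aS ab).
      by rewrite (connect_trans va ab) orbT.
    have Sneg b : b \in S -> ~~ connect limp (v, c) (lneg b).
      move=> bS; apply/negP => /connect_lneg; rewrite lnegK => /(Scl _ _ bS).
      by apply/negP; exact: vN.
    case/orP=> [aS|va]; rewrite negb_or; first by rewrite Scons ?Sneg.
    apply/andP; split.
      by apply/negP => /Sneg; rewrite lnegK va.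
    apply: contra nc => /connect_lneg; rewrite lnegK.
    exact: connect_trans.
  move/Smax => S'S; suff : #|S| < #|S'| by rewrite ltnNge (S'S : #|S'| <= #|S|).
  apply/proper_card/properP; split; first exact: finset.subsetUl.
  by exists (v, c); rewrite ?vN // !inE connect0 orbT.
exists (fun v => (v, true) \in S) => c u v Ecuv.
(* Totality and consistency make the definition of the coloring symmetric in the two colors. *)
have inS w : (((w, true) \in S) == c) = ((w, c) \in S).
  have [d dS] := total w; have := Scons _ dS; rewrite /lneg /=.
  by move: dS; case: d; case: c {Ecuv} => /= dS /negPf nS; rewrite ?dS ?nS.
rewrite !inS -negb_and; apply/andP => -[uS vS].
have /(Scl _ _ uS) : connect limp (u, c) (v, ~~ c).
  by apply: connect1; rewrite /limp /= eqxx.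
by apply/negP; exact: Scons vS.
Qed.

End Implication.
Arguments lneg {V} a.

(** * Extracting a bicycle from an unsatisfiable instance *)

Section Bicycle.
Variables (V : finType) (E : bool -> rel V).
Hypothesis E_sym : forall c, symmetric (E c).
Hypothesis E_irr : forall c, irreflexive (E c).
Hypothesis E_disj : forall c u v, E c u v -> ~~ E (~~ c) u v.

Local Notation limp := (limp E).

(* w is a path whose edges alternate in color, starting with c, and two more
   edges join its ends to w_i and w_j, each having the color that continues
   the alternation beyond that end. The index condition says that the
   size w + 1 edges are distinct: without it an even alternating cycle, whose
   expected number does not vanish, would qualify. *)
Definition bicycle_index (k i j : nat) : bool :=
  [&& 1 < i < k, j.+2 < k & (j, k.-1) != (0, i)].

Definition bicycle_edges (k i j : nat) (c : bool) : seq (nat * nat * bool) :=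
  [:: (0, i, ~~ c), (j, k.-1, c (+) odd k.-1)
    & [seq (r, r.+1, c (+) odd r) | r <- iota 0 k.-1]].

Definition bicycle (x0 : V) (w : seq V) (i j : nat) (c : bool) : bool :=
  [&& uniq w, bicycle_index (size w) i j &
    all (fun e => E e.2 (nth x0 w e.1.1) (nth x0 w e.1.2))
        (bicycle_edges (size w) i j c)].

Lemma limp_sorted_alternates (a0 : V * bool) (s : seq (V * bool)) (r : nat) :
  sorted limp s -> r < size s ->
  (nth a0 s r).2 = (nth a0 s 0).2 (+) odd r.
Proof.
move/sortedP=> /(_ a0) H; elim: r => [|r IHr] rs; first by rewrite addbF.
have /andP[/eqP-> _] := H _ rs.
by rewrite IHr ?(ltnW rs) //= addbN.
Qed.

(** The literals [a] and [b] prolong the path at its two ends and fall back onto its vertices. The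
    last hypothesis excludes a closed cycle, where both extra edges would join the two ends of the
    path. *)
Lemma bicycle_of_limp_path (x0 : V) (s : seq (V * bool)) (a b : V * bool) :
  sorted limp s -> s != [::] -> uniq (map fst s) ->
  limp a (head a s) -> limp (last a s) b ->
  a.1 \in map fst s -> b.1 \in map fst s ->
  ~~ ((b.1 == (head a s).1) && (a.1 == (last a s).1)) ->
  exists i j c, bicycle x0 (map fst s) i j c.
Proof.
have pred2K m l : 1 < l -> l < m -> m.-2.+1 = m.-1 by lia.
have lt_pred2 m l : l < m -> l != m.-1 -> l != m.-2 -> l.+2 < m by lia.
move=> ss sN us; rewrite -nth0 -nth_last => aw wb aS bS nab.
set w := map fst s in us aS bS *.
set k := size s in wb nab.
have kw : size w = k by rewrite size_map.
have k0 : 0 < k by rewrite lt0n size_eq0.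
have wE r : r < k -> nth x0 w r = (nth a s r).1.
  by move=> rk; rewrite (nth_map a).
pose c := (nth a s 0).2; pose i := index a.1 w; pose j := index b.1 w.
have ik : i < k by rewrite -kw index_mem.
have jk : j < k by rewrite -kw index_mem.
have iE : nth x0 w i = a.1 by rewrite nth_index.
have jE : nth x0 w j = b.1 by rewrite nth_index.
have colE r : r < k -> (nth a s r).2 = c (+) odd r.
  exact: limp_sorted_alternates.
have pathE r : r.+1 < k -> E (c (+) odd r) (nth x0 w r) (nth x0 w r.+1).
  move=> rk; have /sortedP - /(_ a) /(_ _ rk) /andP[_] := ss.
  by rewrite colE ?(ltnW rk) // -!wE // (ltnW rk).
have k1k : k.-1 < k by rewrite prednK.
have firstE : E (~~ c) (nth x0 w 0) (nth x0 w i).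
  case/andP: aw => /eqP; rewrite -/c iE wE // => ->; rewrite negbK.
  by rewrite E_sym.
have lastE : E (c (+) odd k.-1) (nth x0 w j) (nth x0 w k.-1).
  by case/andP: wb => _; rewrite colE // E_sym jE wE.
exists i, j, c; rewrite /bicycle us kw /=.
(* [i = 0] would be a loop, and [i = 1] would give the first path edge both colors; the bound on [j]
   is the mirror image. *)
have i1 : 1 < i.
  case: i {iE} ik firstE => [|[|//]] ik; first by rewrite E_irr.
  by have /E_disj/negPf := pathE _ ik; rewrite addbF => ->.
have k2 : k.-2.+1 = k.-1 by apply: pred2K i1 ik.
have j2 : j.+2 < k.
  have jk1 : j != k.-1 by apply: contraTneq lastE => ->; rewrite E_irr.
  apply: lt_pred2 jk jk1 _; apply: contraTneq lastE => ->.
  have /E_disj : E (c (+) odd k.-2) (nth x0 w k.-2) (nth x0 w k.-1).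
    by rewrite -k2; apply: pathE; rewrite k2.
  by rewrite -k2 /= addbN.
apply/and3P; split.
- rewrite /bicycle_index i1 ik j2 /=; apply: contra nab => /eqP[j0 ki].
  by rewrite -jE j0 wE // eqxx -iE -ki wE // eqxx.
- by rewrite firstE.
rewrite lastE; apply/allP => _ /mapP[r + ->] /=.
by rewrite mem_iota add0n ltn_predRL; exact: pathE.
Qed.

Lemma bicycle_of_unavoidable (x0 : V) :
  ~ (exists sigma, avoids E sigma) ->
  exists w i j c, bicycle x0 w i j c.
Proof.
move=> unsat.
have [x xcontra] : exists x, forall c, connect limp (x, c) (x, ~~ c).
  apply: contra_notP unsat => /forallNP H.
  apply: avoids_of_no_contradiction => // v.
  by have /existsNP[c /negP] := H v; exists c.
have := xcontra true; have := xcontra false; rewrite /=.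
set a := (x, true); set a' := (x, false).
case/connectP=> q pq aq /connectP[p0 pp0 ap0].
case/shortenP: pp0 ap0 => p pp up _ ap {p0}.
(* Contraposing the walk q, p and q together form a walk of literals through
   a; it is followed from a in both directions until a vertex repeats. *)
have px1 : ~~ uniq (map fst p ++ [:: x]).
  rewrite uniq_catC cat1s cons_uniq negb_and negbK; apply/orP; left.
  case/lastP: p {pp up} ap => // p d; rewrite last_rcons => <-.
  by rewrite map_rcons mem_rcons inE eqxx.
have [//|p1 [b [p2 [pE u1 b1]]]] := first_repeat _ px1.
have b1' : b.1 \in map fst (a :: p1).
  by move: b1; rewrite mem_cat inE orbC -in_cons.
have u1' : uniq (map fst (a :: p1)) by move: u1; rewrite uniq_catC.
have qx1 : ~~ uniq (map fst q ++ map fst (a :: p1)).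
  rewrite cat_uniq !negb_and; apply/orP; right; apply/orP; left.
  rewrite negbK; apply/hasP; exists x; first exact: mem_head.
  case/lastP: q {pq} aq => // q d; rewrite last_rcons => <-.
  by rewrite map_rcons mem_rcons inE eqxx.
have [//|q1 [d [q2 [qE uq1 d1]]]] := first_repeat _ qx1.
move: pp up pq; rewrite pE qE !cat_path /= mem_cat inE !negb_or.
move=> /and3P[pp1 pb _] /andP[/and3P[_ ab _] _] /and3P[pq1 qd _].
pose s := rev (map lneg q1) ++ a :: p1.
have sE : map fst s = rev (map fst q1) ++ map fst (a :: p1).
  by rewrite map_cat map_rev -map_comp.
have memsE : map fst s =i map fst q1 ++ map fst (a :: p1).
  by move=> y; rewrite sE !mem_cat mem_rev.
have hs : forall z, head z s = lneg (last a' q1).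
  move=> z; case/lastP: (q1) @s {sE memsE} => //= r y.
  by rewrite map_rcons rev_rcons last_rcons.
have ls : forall z, last z s = last a p1.
  by move=> z; rewrite last_cat.
exists (map fst s); apply: (@bicycle_of_limp_path x0 s (lneg d) b).
- rewrite /s sorted_cat_cons pp1 andbT.
  have -> : a = lneg a' by [].
  rewrite -rev_cons -map_cons rev_sorted sorted_map.
  by rewrite (eq_sorted (e' := limp)) // => y z; exact: limp_lneg.
- by rewrite /s; case: (rev _).
- have /perm_uniq-> // : perm_eq (map fst s) (map fst q1 ++ map fst (a :: p1)).
  by rewrite sE perm_cat2r perm_rev.
- by rewrite hs limp_lneg.
- by rewrite ls.
- by rewrite memsE.
- by rewrite memsE mem_cat b1' orbT.
(* p has no repeated literal, so it cannot come back to a itself: this is what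
   rules out a closed alternating cycle. *)
rewrite hs ls; apply/negP => /andP[/eqP bE /eqP dE].
(* The vertices of [q1] avoid those of [a :: p1], to which [b] returns; so [b] can meet the head of
   [s] only at [x]. *)
have q10 : q1 = [::].
  case/lastP: q1 bE uq1 {pq1 qd d1 qE s sE memsE hs ls dE} => // q1 y.
  rewrite last_rcons cat_uniq => bE /and3P[_ /hasP[]].
  exists b.1 => //.
  by rewrite bE /= map_rcons mem_rcons mem_head.
move: bE dE qd; rewrite q10 /= => bE dE /andP[_ /=].
have b2 : b.2 = false.
  by apply: contra_neqF ab => b2; rewrite /a [b]surjective_pairing bE b2.
(* The edge into [b] has color [true] and the edge from [a'] to [d] has color [false], yet they join
   the same two vertices. *)
move: pb => /andP[]; rewrite bE b2 => /eqP/esym/negbFE -> /E_disj/negPf.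
by rewrite E_sym -dE /= => ->.
Qed.

End Bicycle.

(** * Bicycles in edge-colored graphs *)

Section ColoredGraph.
Variables (V : finType) (Gc : ecgraph V).

(** Sets that are not pairs get [None], which makes loops non-edges. *)
Definition edge_color (s : {set V}) : option color :=
  obind Gc (insub s : option (vpair V)).

Definition has_edge (c : bool) (u v : V) : bool :=
  edge_color [set u; v]%SET == Some c.

Lemma edge_color_val (e : vpair V) : edge_color (val e) = Gc e.
Proof. by rewrite /edge_color valK. Qed.

Lemma edge_color_card (s : {set V}) (c : color) :
  edge_color s = Some c -> #|s| == 2.
Proof. by rewrite /edge_color; case: insubP. Qed.

Lemma has_edge_sym (c : bool) : symmetric (has_edge c).
Proof. by move=> u v; rewrite /has_edge finset.setUC. Qed.

Lemma has_edge_irr (c : bool) : irreflexive (has_edge c).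
Proof.
by move=> u; apply/negP => /eqP/edge_color_card; rewrite finset.setUid cards1.
Qed.

Lemma has_edge_disj (c : bool) (u v : V) :
  has_edge c u v -> ~~ has_edge (~~ c) u v.
Proof. by rewrite /has_edge => /eqP ->; case: c. Qed.

Lemma bicycle_of_not_adaptably_2_colorable (x0 : V) :
  ~~ adaptably_2_colorable Gc ->
  exists w i j c, bicycle has_edge x0 w i j c.
Proof.
move=> /existsPn nocol; apply: bicycle_of_unavoidable.
- exact: has_edge_sym.
- exact: has_edge_irr.
- exact: has_edge_disj.
case=> sigma sigmaP; have /negP[] := nocol [ffun v => sigma v].
apply/forallP => e; apply/forallP => u; apply/forallP => v.
apply/implyP => /eqP eE; case Ge: (Gc e) => [k|//]; rewrite !ffunE.
by apply: sigmaP; rewrite /has_edge -eE edge_color_val Ge.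
Qed.

End ColoredGraph.

Local Open Scope ring_scope.

(** * Probability estimates in the random colored graph *)

Section Probability.
Variables (R : realType) (n : nat) (p : R).
Hypothesis p01 : 0 <= p <= 1.

Local Notation graph := (ecgraph 'I_n).
Local Notation P := (Gnp2_prob p).

Lemma Gnp2_prob_ge0 (A : pred graph) : 0 <= P A.
Proof. by apply: sumr_ge0 => Gc _; apply: Gnp2_mass_ge0. Qed.

Lemma Gnp2_prob_le (A B : pred graph) :
  (forall Gc, A Gc -> B Gc) -> P A <= P B.
Proof.
move=> AB; rewrite /Gnp2_prob big_mkcond [leRHS]big_mkcond.
apply: ler_sum => Gc _; case: ifP => [/AB -> //|_].
by case: ifP => // _; apply: Gnp2_mass_ge0.
Qed.

Lemma Gnp2_prob_compl (A : pred graph) : P A = 1 - P (predC A).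
Proof.
rewrite -(Gnp2_prob_total n p) /Gnp2_prob [in RHS](bigID A) /=.
by rewrite addrK.
Qed.

Lemma Gnp2_prob_union (I : finType) (Q : pred I) (A : pred graph)
    (B : I -> pred graph) :
  (forall Gc, A Gc -> exists2 i, Q i & B i Gc) ->
  P A <= \sum_(i | Q i) P (B i).
Proof.
move=> AB; rewrite /Gnp2_prob.
under [leRHS]eq_bigr do rewrite big_mkcond.
rewrite exchange_big /= big_mkcond; apply: ler_sum => Gc _.
have t_ge0 i : 0 <= (if B i Gc then Gnp2_mass p Gc else 0).
  by case: ifP => // _; apply: Gnp2_mass_ge0.
case: ifP => [/AB[i Qi Bi]|_]; last by apply: sumr_ge0.
by rewrite (bigD1 i) //= Bi lerDl sumr_ge0.
Qed.

(** By independence the probability is at most a product over all pairs: a prescribed pair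
    contributes at most [p / 2], any other at most 1. If some prescribed set is not a pair, the
    event is empty. *)
Lemma Gnp2_prob_edges (es : seq ({set 'I_n} * color)) :
  uniq (map fst es) ->
  P (fun Gc => all (fun x => edge_color Gc x.1 == Some x.2) es)
    <= (p / 2) ^+ size es.
Proof.
have /andP[p0 p1] := p01; have hp : 0 <= p / 2 by rewrite divr_ge0.
have w0 o : 0 <= pair_weight p o by case: o => [c|] /=; rewrite ?subr_ge0.
have w1 : \sum_o pair_weight p o = 1.
  rewrite (bigD1 None) //= (bigD1 (Some red)) //= (bigD1 (Some blue)) //=.
  rewrite big1 ?addr0; last by case=> [[]|].
  by rewrite -mulrDr -div1r -splitr mulr1 subrK.
move=> ues; case: (boolP (all (fun s : {set 'I_n} => #|s| == 2) (map fst es))).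
  move=> card2.
  pose Q (e : vpair 'I_n) : pred (option color) :=
    fun o => all (fun x => (val e == x.1) ==> (o == Some x.2)) es.
  pose F (e : vpair 'I_n) : R := if val e \in map fst es then p / 2 else 1.
  apply: (@le_trans _ _ (P (fun Gc => Gc \in family Q))).
    apply: Gnp2_prob_le => Gc /allP H; apply/familyP => e; apply/allP => x xes.
    by apply/implyP => /eqP eE; rewrite -edge_color_val eE H.
  rewrite /Gnp2_prob /Gnp2_mass -(bigA_distr_big_dep _ (fun=> pair_weight p)).
  apply: (@le_trans _ _ (\prod_e F e)).
    apply: ler_prod => e _; rewrite sumr_ge0 //= /F; case: ifP => [|_].
      case/mapP => x xes eE.
      have -> : p / 2 = \sum_(o | o == Some x.2) pair_weight p o.
        by rewrite big_pred1_eq.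
      rewrite big_mkcond [leRHS]big_mkcond; apply: ler_sum => o _.
      case: ifP => [/allP/(_ _ xes)|_]; last by case: ifP.
      by rewrite eE eqxx /= => ->.
    rewrite -[leRHS]w1 big_mkcond; apply: ler_sum => o _.
    by case: ifP.
  rewrite /F -big_mkcond prodr_const.
  suff -> : #|[pred e : vpair 'I_n | val e \in map fst es]| = size es by [].
  pose es2 : seq (vpair 'I_n) := pmap insub (map fst es).
  have <- : size es2 = size es.
    rewrite size_pmap_sub -(size_map fst es); apply/eqP.
    by rewrite -all_count.
  rewrite -(card_uniqP (pmap_sub_uniq _ ues)); apply: eq_card => e.
  by rewrite inE mem_pmap_sub.
move=> /allPn[s /mapP[x xes ->] xcard].
rewrite /Gnp2_prob big_pred0 ?exprn_ge0 // => Gc.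
apply/negP => /allP/(_ _ xes)/eqP/edge_color_card.
by rewrite (negPf xcard).
Qed.

End Probability.

(** * The union bound over bicycles *)

Lemma bicycle_edges_uniq (V : finType) (x0 : V) (w : seq V) (i j : nat)
    (c : bool) :
  uniq w -> bicycle_index (size w) i j ->
  uniq [seq [set nth x0 w e.1.1; nth x0 w e.1.2]%SET
       | e <- bicycle_edges (size w) i j c].
Proof.
move=> uw /and3P[/andP[i1 ik] jk jki].
pose edge (e : nat * nat) := [set nth x0 w e.1; nth x0 w e.2]%SET.
rewrite (map_comp edge fst (bicycle_edges _ _ _ _)) map_inj_in_uniq.
  rewrite /= -map_comp !inE negb_or eq_sym jki /=; apply/and3P; split.
  - by apply/mapP => -[r _ [<- iE]]; rewrite iE in i1.
  - by apply/mapP => -[r _ [jr rE]]; lia.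
  - by rewrite map_inj_uniq ?iota_uniq // => r s [].
(* Every edge lists its smaller index first, so its vertex set determines the index pair. *)
have lt2 e : e \in map fst (bicycle_edges (size w) i j c) ->
    (e.1 < e.2 < size w)%N.
  rewrite /= -map_comp !inE => /or3P[/eqP->|/eqP->|/mapP[r]] /=; [lia..|].
  by rewrite mem_iota => rk -> /=; lia.
move=> [a b] [a' b'] /lt2 /= /andP[ab bw] /lt2 /= /andP[ab' bw'] E.
have nthE u v : (u < size w)%N -> (v < size w)%N ->
    (nth x0 w u == nth x0 w v) = (u == v) by move=> uk vk; rewrite nth_uniq.
have aw : (a < size w)%N by exact: ltn_trans bw.
have aw' : (a' < size w)%N by exact: ltn_trans bw'.
have : nth x0 w a \in edge (a', b') by rewrite -E set21.
have : nth x0 w b \in edge (a', b') by rewrite -E set22.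
have : nth x0 w a' \in edge (a, b) by rewrite E set21.
rewrite !inE /= !nthE //.
by move=> h1 h2 h3; congr pair; lia.
Qed.

Lemma Gnp2_prob_bicycle (R : realType) (n : nat) (p : R) (x0 : 'I_n)
    (w : seq 'I_n) (i j : nat) (c : bool) : 0 <= p <= 1 ->
  Gnp2_prob p (fun Gc => bicycle (has_edge Gc) x0 w i j c)
    <= (p / 2) ^+ (size w).+1.
Proof.
move=> p01; have hp : 0 <= p / 2 by case/andP: p01 => p0 _; rewrite divr_ge0.
case: (boolP (uniq w && bicycle_index (size w) i j)) => [/andP[uw ijw]|nw].
  pose f (e : nat * nat * bool) : {set 'I_n} * color :=
    ([set nth x0 w e.1.1; nth x0 w e.1.2]%SET, e.2).
  pose es := map f (bicycle_edges (size w) i j c).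
  have <- : size es = (size w).+1.
    rewrite size_map /= size_map size_iota; case/and3P: ijw => _ /ltn_predK.
    by case: (size w).
  apply: le_trans (Gnp2_prob_edges p01 _).
    apply: Gnp2_prob_le => // Gc /and3P[_ _]; rewrite all_map.
    by apply: sub_all.
  by rewrite -map_comp; exact: bicycle_edges_uniq.
rewrite /Gnp2_prob big_pred0 ?exprn_ge0 // => Gc.
by rewrite /bicycle andbA (negPf nw).
Qed.

Lemma Gnp2_prob_not_colorable (R : realType) (n : nat) (p : R) :
  (0 < n)%N -> 0 <= p <= 1 ->
  Gnp2_prob p (predC (@adaptably_2_colorable 'I_n)) <=
    \sum_(k < n.+1) (n%:R ^+ k * k%:R ^+ 2 * 2) * (p / 2) ^+ k.+1.
Proof.
case: n => // m; set n := m.+1 => _ p01; pose x0 : 'I_n := ord0.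
pose T k : finType := (k.-tuple 'I_n * 'I_k * 'I_k * bool)%type.
pose B k (t : T k) (Gc : ecgraph 'I_n) :=
  bicycle (has_edge Gc) x0 t.1.1.1 t.1.1.2 t.1.2 t.2.
apply: (@le_trans _ _ (\sum_(k < n.+1)
    Gnp2_prob p (fun Gc => [exists t : T k, B k t Gc]))).
  apply: Gnp2_prob_union => // Gc.
  move=> /(bicycle_of_not_adaptably_2_colorable x0)[w [i [j [c bw]]]].
  have /and3P[uw /and3P[/andP[_ iw] jw _] _] := bw.
  (* The path has distinct vertices, hence at most [n] of them. *)
  have wn : (size w < n.+1)%N.
    by rewrite ltnS -(card_uniqP uw) -[leqRHS]card_ord max_card.
  exists (Ordinal wn) => //; apply/existsP.
  have jw' : (j < size w)%N by lia.
  by exists (in_tuple w, Ordinal iw, Ordinal jw', c).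
apply: ler_sum => k _.
apply: (@le_trans _ _ (\sum_(t : T k) Gnp2_prob p (B k t))).
  by apply: Gnp2_prob_union => // Gc /existsP[t Bt]; exists t.
apply: (@le_trans _ _ (\sum_(t : T k) (p / 2) ^+ k.+1)).
  apply: ler_sum => t _; rewrite -[in leRHS](size_tuple t.1.1.1).
  exact: Gnp2_prob_bicycle.
rewrite sumr_const !card_prod card_tuple !card_ord card_bool.
by rewrite -[leLHS]mulr_natl !natrM natrX expr2 !mulrA.
Qed.

(** * The sum of k^2 q^k *)

Lemma sum_sqr_geometric (R : comRingType) (q : R) (N : nat) :
  (1 - q) ^+ 3 * \sum_(k < N) k%:R ^+ 2 * q ^+ k =
  q * (1 + q) - q ^+ N *
    (N%:R ^+ 2 * (1 - q) ^+ 2 + 2 * N%:R * q * (1 - q) + q * (1 + q)).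
Proof.
elim: N => [|N IHN]; first by rewrite big_ord0 expr0; ring.
rewrite big_ord_recr /= mulrDr IHN (exprS q N) -[N.+1%:R]natr1; ring.
Qed.

(** In the closed form the subtracted term is nonnegative and [q * (1 + q)] is at most 2. *)
Lemma sum_sqr_geometric_le (R : realFieldType) (q : R) (N : nat) :
  0 <= q < 1 -> \sum_(k < N) k%:R ^+ 2 * q ^+ k <= 2 / (1 - q) ^+ 3.
Proof.
case/andP=> q0 q1; have d0 : 0 < 1 - q by rewrite subr_gt0.
rewrite ler_pdivlMr ?exprn_gt0 // mulrC sum_sqr_geometric.
rewrite lerBlDr (@le_trans _ _ 2) //; first by nra.
rewrite lerDl mulr_ge0 ?exprn_ge0 // !addr_ge0 //.
- by rewrite mulr_ge0 ?exprn_ge0 ?(ltW d0).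
- by rewrite !mulr_ge0 ?(ltW d0).
- by rewrite mulr_ge0 ?addr_ge0.
Qed.

Lemma Gnp2_prob_not_colorable_le (R : realType) (n : nat) (p eps : R) :
  (0 < n)%N -> 0 <= p <= 1 -> 0 < eps -> p = 2 * (1 - eps) / n%:R ->
  Gnp2_prob p (predC (@adaptably_2_colorable 'I_n)) <= 4 / (n%:R * eps ^+ 3).
Proof.
move=> n0 p01 eps0 pE; have nR : 0 < n%:R :> R by rewrite ltr0n.
pose q : R := 1 - eps.
have p2 : p / 2 = q / n%:R by rewrite pE /q; by field; rewrite (gt_eqF nR).
(* [eps <= 1] is implicit in [0 <= p]. *)
have q0 : 0 <= q.
  have -> : q = p / 2 * n%:R by rewrite p2 divfK // gt_eqF.
  by case/andP: p01 => p0 _; rewrite mulr_ge0 ?divr_ge0.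
have q1 : q < 1 by rewrite /q; lra.
apply: le_trans (Gnp2_prob_not_colorable n0 p01) _.
apply: (@le_trans _ _ (2 / n%:R * \sum_(k < n.+1) k%:R ^+ 2 * q ^+ k)).
  rewrite mulr_sumr; apply: ler_sum => k _.
  rewrite p2 expr_div_n (exprS q) (exprS n%:R).
  (* The extra edge of a bicycle leaves a factor [q / n]; its [q] is then bounded by 1. *)
  have -> : n%:R ^+ k * k%:R ^+ 2 * 2 * (q * q ^+ k / (n%:R * n%:R ^+ k)) =
      q * (2 / n%:R * (k%:R ^+ 2 * q ^+ k)).
    by field; rewrite expf_neq0 gt_eqF.
  by rewrite ler_piMl ?(ltW q1) // !mulr_ge0 ?invr_ge0 ?exprn_ge0 // ltW.
have q01 : 0 <= q < 1 by rewrite q0.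
apply: le_trans (ler_wpM2l _ (sum_sqr_geometric_le n.+1 q01)) _.
  by rewrite divr_ge0 // ltW.
rewrite (_ : 1 - q = eps); last by rewrite /q; ring.
rewrite le_eqVlt; apply/orP; left; apply/eqP; field.
by rewrite !gt_eqF.
Qed.

(** * Passage to the limit *)

Local Open Scope classical_set_scope.

Theorem theorem1p4 (R : realType) (lambda : nat -> R) (p : nat -> R)
    (lambda_gt0 : forall n : nat, 0 < lambda n)
    (lambda_oo : lambda n @[n --> \oo] --> +oo)
    (pE : forall n : nat,
       p n = 2 * (1 - lambda n * n%:R `^ (- (1 / 3))) / n%:R)
    (p01 : \forall n \near \oo, 0 <= p n <= 1) :
  Gnp2_prob (p n) (@adaptably_2_colorable 'I_n) @[n --> \oo] --> (1 : R).
Proof.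
have lim0 : 1 - 4 / lambda n @[n --> \oo] --> (1 : R).
  rewrite -[X in _ --> X]subr0; apply: cvgB; first exact: cvg_cst.
  rewrite -(mulr0 4); apply: cvgM; first exact: cvg_cst.
  apply/gtr0_cvgV0 => //; exact: nearW.
apply: (@squeeze_cvgr _ _ _ _ (fun n => 1 - 4 / lambda n) (fun=> 1));
  last 2 first.
- exact: lim0.
- exact: cvg_cst.
near=> n.
have n0 : (0 < n)%N by near: n; exact: nbhs_infty_gt.
(* This lets [4 / lambda n] replace the sharper [4 / lambda n ^+ 3]. *)
have l1 : 1 <= lambda n by near: n; apply: (cvgryPge _).1.
have pn : 0 <= p n <= 1 by near: n.
have nR : 0 < n%:R :> R by rewrite ltr0n.
rewrite Gnp2_prob_compl gerBl Gnp2_prob_ge0 // andbT lerD2l lerN2.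
have eps0 : 0 < lambda n * n%:R `^ (- (1 / 3)) by rewrite mulr_gt0 ?powR_gt0.
apply: le_trans (Gnp2_prob_not_colorable_le n0 pn eps0 (pE n)) _.
(* The exponent -1/3 is what cancels the factor [n] after cubing. *)
have -> : n%:R * (lambda n * n%:R `^ (- (1 / 3))) ^+ 3 = lambda n ^+ 3.
  rewrite exprMn -[X in _ * (_ * X)]powR_mulrn ?powR_ge0 // -powRrM.
  rewrite (_ : - (1 / 3) * 3 = -1); last by field.
  rewrite (powR_inv1 (ltW nR)); by field; rewrite (gt_eqF nR).
rewrite ler_pM2l // lef_pV2 ?posrE ?exprn_gt0 //.
by rewrite ler_eXnr.
Unshelve. all: by end_near.
Qed.
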